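(* Let $f(X)=a_{0}+a_{1}X+\cdots +a_{n}X^{n}\in \mathbb{Z}[X]$, $a_{0}a_{n}\neq 0$. Suppose there exist two distinct prime numbers $p$ and $q$ and two distinct indices $j_{1},j_{2}\in \{1,\dots ,n-1\}$ such that $j_{1}+j_{2}\neq n$ and (i) $\frac{\nu _{p}(a_{0})}{n}>\frac{\nu _{p}(a_{j_{1}})}{n-j_{1}}$; $\nu _{p}(a_{i}) > \frac{j_{1}-i}{j_{1}}\, \nu _{p}(a_{0})+\frac{i}{j_{1}}\, \nu _{p}(a_{j_{1}})$ for $0<i<j_{1}$; $\nu _{p}(a_{j_{1}})>0$; $\frac{\nu _{p}(a_{i})}{n-i} > \frac{\nu _{p}(a_{j_{1}})}{n-j_{1}}$ for $j_{1}<i<n$; and $\nu _{p}(a_{n}) = 0$; (ii) $\nu _{q}(a_{0}) = 0$; $\frac{\nu _{q}(a_{i})}{i} > \frac{\nu _{q}(a_{j_{2}})}{j_{2}}$ for $0<i<j_{2}$; $\nu _{q}(a_{j_{2}})>0$; $\nu _{q}(a_{i}) > \frac{n-i}{n-j_{2}}\, \nu _{q}(a_{j_{2}})+\frac{i-j_{2}}{n-j_{2}}\, \nu _{q}(a_{n})$ for $j_{2}<i<n$; and $\frac{\nu _{q}(a_{n})}{n}>\frac{\nu _{q}(a_{j_{2}})}{j_{2}}$; (iii) $\gcd(\nu _{p}(a_{0})-\nu _{p}(a_{j_{1}}),j_{1})=\gcd(\nu _{p}(a_{j_{1}}),n-j_{1})=1$ and $\gcd(\nu _{q}(a_{j_{2}}),j_{2})=\gcd(\nu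 _{q}(a_{n})-\nu _{q}(a_{j_{2}}),n-j_{2})=1$. Then $f$ is irreducible over $\mathbb{Q}$.
   Context: For a prime $p$ and a nonzero integer $m$, $\nu_p(m)$ is the largest integer $i$ such that $p^i\mid m$; by convention $\nu_p(0)=\infty$ (so lower bounds on $\nu_p(a_i)$ hold automatically when $a_i=0$). *)

(* Defs.v *)
From HB Require Import structures.
From mathcomp Require Import all_boot all_order all_algebra.
From mathcomp Require Import constructive_ereal.

Set Implicit Arguments.
Unset Strict Implicit.
Unset Printing Implicit Defensive.

Import Order.TTheory GRing.Theory Num.Theory.

Local Open Scope ring_scope.

(* [vint p m] is the p-adic valuation of m for m != 0 and p prime; since
   [logn p 0 = 0], its value at m = 0 is junk. *)
Definition vint (p : nat) (m : int) : int := (logn p `|m|%N)%:Z.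

Definition nu (p : nat) (m : int) : \bar rat :=
  if m == 0 then +oo%E else ((vint p m)%:~R)%:E.

(* Main.v *)
(* Dumas' argument.  The hypotheses say that the Newton polygon of [f] at [p]
   has the vertices 0, [j1], [n], that at [q] the vertices 0, [j2], [n], and
   that no edge contains a lattice point other than its endpoints.  Newton
   polygons of products are obtained by concatenating the edges of the factors
   by slope, so such an edge belongs entirely to one factor; hence a factor of
   [f] over the integers has degree 0, [j1], [n - j1] or [n], and also 0, [j2],
   [n - j2] or [n], which leaves only 0 and [n]. *)
Require Import Defs.
From HB Require Import structures.
From mathcomp Require Import all_boot all_order all_algebra.
From mathcomp Require Import constructive_ereal zify ring.

Set Implicit Arguments.
Unset Strict Implicit.
Unset Printing Implicit Defensive.

Import Order.TTheory GRing.Theory Num.Theory.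

Local Open Scope ring_scope.

(** * Valuations, weights and the vocabulary of Newton polygons *)

Lemma vintM (p : nat) (x y : int) :
  x != 0 -> y != 0 -> vint p (x * y) = vint p x + vint p y.
Proof.
by move=> x0 y0; rewrite /vint abszM lognM ?absz_gt0 // PoszD.
Qed.

Lemma pfactor_dvdz (p m : nat) (x : int) :
  prime p -> x != 0 -> ((p ^ m)%N%:Z %| x)%Z = (m%:Z <= vint p x).
Proof.
by move=> pp x0; rewrite dvdzE absz_nat pfactor_dvdn ?absz_gt0.
Qed.

Lemma coef_neq0_ltn (R : nzRingType) (g : {poly R}) i :
  g`_i != 0 -> (i < size g)%N.
Proof. by move=> gi; rewrite ltnNge; apply: contra gi => /leq_sizeP ->. Qed.

(* The Newton polygon of [g] at [p] has the points [(i, vint p g`_i)].  The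
   linear form [w * y + d * i] is constant along lines of slope [- d / w]. *)
Definition weight (p : nat) (w d : int) (g : {poly int}) (i : nat) : int :=
  w * vint p g`_i + d * i%:Z.

Definition strict_min (p : nat) (w d : int) (g : {poly int}) (s : nat) : Prop :=
  g`_s != 0 /\
  forall i, g`_i != 0 -> i != s -> weight p w d g s < weight p w d g i.

(** The case [s = t] is allowed: a slope that no side of the polygon has gives a single vertex, so a
    nonzero polynomial has an [edge] for every slope. *)
Definition edge (p : nat) (w d : int) (g : {poly int}) (s t : nat) : Prop :=
  [/\ g`_s != 0, g`_t != 0, weight p w d g s = weight p w d g t &
   forall i, g`_i != 0 -> weight p w d g s < weight p w d g i \/
     weight p w d g i = weight p w d g s /\ (s <= i <= t)%N].

Lemma strict_min_uniq p w d g s t :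
  strict_min p w d g s -> strict_min p w d g t -> s = t.
Proof.
move=> [gs sP] [gt tP]; case: (eqVneq s t) => // st.
by have := sP t gt; have := tP s gs st; rewrite eq_sym => ? /(_ st); lia.
Qed.

(** * Vertices of a product *)

Section Products.

Variables (p : nat) (w d : int) (g h : {poly int}) (s t : nat).
Hypotheses (p_prime : prime p) (w_gt0 : 0 < w).
Hypotheses (gs : strict_min p w d g s) (ht : strict_min p w d h t).

Lemma strict_min_pair i j : g`_i != 0 -> h`_j != 0 -> (i, j) != (s, t) ->
  weight p w d g s + weight p w d h t < weight p w d g i + weight p w d h j.
Proof.
case: gs ht => [_ sP] [_ tP] gi hj; rewrite xpair_eqE negb_and.
have := sP i gi; have := tP j hj.
case: (eqVneq i s) => [->|_]; case: (eqVneq j t) => [->|_] //= tj si _.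
- by rewrite ltrD2l tj.
- by rewrite ltrD2r si.
- by rewrite ltrD ?tj ?si.
Qed.

(* [m] plays the role of the valuation of a coefficient of [g * h] that is no
   heavier than the one at [s + t]. *)
Lemma dvdz_conv_term i j (m : nat) : (i, j) != (s, t) ->
  w * m%:Z + d * (i + j)%:Z <= weight p w d g s + weight p w d h t ->
  ((p ^ m.+1)%N%:Z %| g`_i * h`_j)%Z.
Proof.
move=> ij le_m; have [->|gi] := eqVneq g`_i 0; first by rewrite mul0r dvdz0.
have [->|hj] := eqVneq h`_j 0; first by rewrite mulr0 dvdz0.
rewrite pfactor_dvdz ?mulf_neq0 // vintM //.
have := strict_min_pair gi hj ij; rewrite /weight in le_m * => lt_ij.
have : w * m%:Z < w * (vint p g`_i + vint p h`_j) by lia.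
by rewrite ltr_pM2l //; lia.
Qed.

(** In the convolution at [s + t], only the product of the coefficients at [s] and [t] escapes
    divisibility by [p ^ m.+1], so the sum has the valuation [m] of that product. *)
Lemma strict_minM : strict_min p w d (g * h) (s + t).
Proof.
have [[gs0 _] [ht0 _]] := (gs, ht).
pose m := (logn p `|(g`_s)%R| + logn p `|(h`_t)%R|)%N.
have mE : m%:Z = vint p g`_s + vint p h`_t by rewrite /m PoszD.
have Dm : ((p ^ m.+1)%N%:Z %| (g * h)`_(s + t) - g`_s * h`_t)%Z.
  rewrite coefM; have st : (s < (s + t).+1)%N by lia.
  rewrite (bigD1 (Ordinal st)) //= addKn addrAC subrr add0r.
  apply: rpred_sum => i; rewrite -val_eqE /= => is_; apply: dvdz_conv_term.
    by rewrite xpair_eqE negb_and is_.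
  have -> : (i + (s + t - i) = s + t)%N by have := ltn_ord i; lia.
  by rewrite mE /weight; lia.
have gh0 : g`_s * h`_t != 0 by rewrite mulf_neq0.
have vst : vint p (g`_s * h`_t) = m by rewrite vintM // mE.
have nD : ~~ ((p ^ m.+1)%N%:Z %| (g * h)`_(s + t))%Z.
  rewrite -[_`_ _](subrK (g`_s * h`_t)) rpredDl //.
  by rewrite pfactor_dvdz // vst; lia.
have st0 : (g * h)`_(s + t) != 0.
  by apply: contraNneq nD => ->; rewrite dvdz0.
have vE : vint p (g * h)`_(s + t) = m.
  apply/eqP; rewrite eq_le; apply/andP; split.
    by move: nD; rewrite pfactor_dvdz //; lia.
  rewrite -pfactor_dvdz // -[_`_ _](subrK (g`_s * h`_t)) rpredDl.
    by rewrite pfactor_dvdz // vst.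
  by apply: dvdz_trans Dm; rewrite dvdzE /= dvdn_exp2l.
have wE : weight p w d (g * h) (s + t) = weight p w d g s + weight p w d h t.
  by rewrite /weight vE mE PoszD; lia.
split=> // k k0 kst; rewrite wE ltNge; apply/negP => le_k.
(* A coefficient no heavier than the one at [s + t] would have all its convolution terms divisible
   by a higher power of [p] than its own valuation permits. *)
have : ((p ^ (logn p `|((g * h)`_k)%R|).+1)%N%:Z %| (g * h)`_k)%Z.
  rewrite [X in (_ %| X)%Z]coefM; apply: rpred_sum => i _.
  have ik : (i + (k - i) = k)%N by have := ltn_ord i; lia.
  apply: dvdz_conv_term; last by rewrite ik.
  by apply: contra kst; rewrite xpair_eqE => /andP[/eqP <- /eqP <-]; rewrite ik.
by rewrite pfactor_dvdz // /vint; lia.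
Qed.

End Products.

(** * Edges of a product *)

(* Tilting the slope of an edge slightly in either direction isolates its
   endpoints. *)
Lemma edge_tilt p w d g s t (N : nat) : edge p w d g s t -> (size g <= N)%N ->
  strict_min p (N%:Z * w) (N%:Z * d + 1) g s /\
  strict_min p (N%:Z * w) (N%:Z * d - 1) g t.
Proof.
move=> [gs gt wst wP] gN.
have lt_N i : g`_i != 0 -> (i < N)%N.
  by move=> /coef_neq0_ltn gi; apply: leq_trans gi gN.
(* Weights are integers, so a nonzero gap is scaled to at least [N], while the tilt changes
   differences by less than [N]; it only decides ties. *)
have wE e i : weight p (N%:Z * w) (N%:Z * d + e) g i =
    N%:Z * weight p w d g i + e * i%:Z by rewrite /weight; ring.
have := lt_N _ gs; have := lt_N _ gt => tN sN.
split; split=> // i gi; rewrite !wE; have := lt_N _ gi; case: (wP i gi); nia.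
Qed.

Lemma edge_exists p w d g : g != 0 -> exists s t, edge p w d g s t.
Proof.
move=> g0; have lg : ((size g).-1 < size g)%N by rewrite prednK ?size_poly_gt0.
have Pl : g`_(Ordinal lg) != 0 by rewrite -lead_coefE lead_coef_eq0.
have [m gm mP] := @arg_minP _ _ _ (Ordinal lg)
  (fun i : 'I_(size g) => g`_i != 0) (fun i => weight p w d g i) Pl.
pose P i := (g`_i != 0) && (weight p w d g i == weight p w d g m).
have exP : exists i, P i by exists m; rewrite /P gm eqxx.
have ubP i : P i -> (i <= size g)%N by case/andP => /coef_neq0_ltn /ltnW.
case: (ex_minnP exP) => s /andP[gs /eqP ws] sP.
case: (ex_maxnP exP ubP) => t /andP[gt /eqP wt] tP.
exists s, t; split=> // [|i gi]; first by rewrite ws wt.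
rewrite ws; have := mP (Ordinal (coef_neq0_ltn gi)) gi; rewrite /= le_eqVlt.
case/orP => [/eqP mi|]; [right|by left].
by rewrite mi sP ?tP // /P gi mi eqxx.
Qed.

(** Tilting, with one [N] large enough for all three polynomials, turns endpoints into strict
    minima, which add under multiplication and are unique. *)
Lemma edgeM p w d g h s t : prime p -> 0 < w -> edge p w d (g * h) s t ->
  exists sg tg sh th, [/\ edge p w d g sg tg, edge p w d h sh th,
    (sg + sh = s)%N & (tg + th = t)%N].
Proof.
move=> pp w0 gh_st; have [gh0 _ _ _] := gh_st.
have /norP[g0 h0] : ~~ ((g == 0) || (h == 0)).
  by rewrite -mulf_eq0; apply: contraNneq gh0 => ->; rewrite coef0.
have [sg [tg eg]] := edge_exists p w d g0.
have [sh [th eh]] := edge_exists p w d h0.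
exists sg, tg, sh, th; split=> //.
all: pose N := (size (g * h)%R + (size g + size h)).+1.
all: have Nw : 0 < N%:Z * w by apply: mulr_gt0.
all: have /(edge_tilt gh_st)[f1 f2] : (size (g * h)%R <= N)%N by rewrite /N; lia.
all: have /(edge_tilt eg)[g1 g2] : (size g <= N)%N by rewrite /N; lia.
all: have /(edge_tilt eh)[h1 h2] : (size h <= N)%N by rewrite /N; lia.
- exact: strict_min_uniq (strict_minM pp Nw g1 h1) f1.
- exact: strict_min_uniq (strict_minM pp Nw g2 h2) f2.
Qed.

(** Equal weights say that [w] times the drop in valuation is [d * (t - s)]. When [w] is the width
    of an edge of a product, a factor thus takes all of that edge or none. *)
Lemma edge_dvdz p w d g s t :
  coprimez d w -> edge p w d g s t -> (w %| t%:Z - s%:Z)%Z.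
Proof.
move=> dw [_ _ + _]; rewrite /weight => wst.
rewrite -(@Gauss_dvdzr _ d) ?[coprimez w d]coprimez_sym //.
apply/dvdzP; exists (vint p g`_s - vint p g`_t); lia.
Qed.

Lemma edge_size p w d g s t : edge p w d g s t -> (s <= t < size g)%N.
Proof.
move=> [gs gt wst wP]; case: (wP t gt) => [|[_ /andP[-> _]]]; first by lia.
exact: coef_neq0_ltn.
Qed.

(** Convexity: edges occur in order of increasing slope [- d / w]. If [s2 < t1], comparing these two
    points in both linear forms and eliminating the valuations contradicts the order of the
    slopes. *)
Lemma edge_leq p w1 d1 w2 d2 g s1 t1 s2 t2 : 0 < w1 -> 0 < w2 ->
  d2 * w1 < d1 * w2 -> edge p w1 d1 g s1 t1 -> edge p w2 d2 g s2 t2 ->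
  (t1 <= s2)%N.
Proof.
move=> w1_0 w2_0 dw [_ gt e1 P1] [gs _ _ P2]; rewrite leqNgt; apply/negP => lt.
have : weight p w1 d1 g t1 <= weight p w1 d1 g s2 by case: (P1 _ gs); lia.
have : weight p w2 d2 g s2 <= weight p w2 d2 g t1 by case: (P2 _ gt); lia.
rewrite /weight => A B.
have : w1 * (w2 * vint p g`_s2 + d2 * s2) <= w1 * (w2 * vint p g`_t1 + d2 * t1).
  by rewrite ler_pM2l.
have : w2 * (w1 * vint p g`_t1 + d1 * t1) <= w2 * (w1 * vint p g`_s2 + d1 * s2).
  by rewrite ler_pM2l.
by nia.
Qed.

Lemma dvdz_nat_eq (a : nat) (k : int) :
  (a%:Z %| k)%Z -> 0 <= k <= a%:Z -> k = 0 \/ k = a%:Z.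
Proof.
case/dvdzP => c -> ck.
have [?|[->|?]] : c <= 0 \/ c = 1 \/ 2 <= c by lia.
all: nia.
Qed.

(** * Polygons with two edges *)

Lemma two_edges_factor_size (p : nat) (g h : {poly int}) (n j : nat)
    (d1 d2 : int) : prime p -> (0 < j < n)%N ->
  (size (g * h)%R <= n.+1)%N ->
  edge p j d1 (g * h) 0 j -> edge p (n - j)%N d2 (g * h) j n ->
  coprimez d1 j -> coprimez d2 (n - j)%N -> d2 * j%:Z < d1 * (n - j)%N%:Z ->
  (size g).-1 \in [:: 0; j; n - j; n]%N.
Proof.
move=> pp jn sgh E1 E2 c1 c2 dd.
have w1 : 0 < j%:Z by lia.
have w2 : 0 < (n - j)%N%:Z by lia.
have [sg [tg [sh [th [g1 h1 s1 t1]]]]] := edgeM pp w1 E1.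
have [sg' [tg' [sh' [th' [g2 h2 s2 t2]]]]] := edgeM pp w2 E2.
have lg := edge_leq w1 w2 dd g1 g2; have lh := edge_leq w1 w2 dd h1 h2.
have := edge_size g1; have := edge_size h1.
have := edge_size g2; have := edge_size h2 => S1 S2 S3 S4.
have g0 : g != 0 by rewrite -size_poly_gt0; lia.
have h0 : h != 0 by rewrite -size_poly_gt0; lia.
rewrite size_mul // in sgh.
have le1 : 0 <= tg%:Z - sg%:Z <= j by lia.
have le2 : 0 <= tg'%:Z - sg'%:Z <= (n - j)%N by lia.
have := dvdz_nat_eq (edge_dvdz c1 g1) le1.
have := dvdz_nat_eq (edge_dvdz c2 g2) le2.
(* The left ends sum to 0, the right ends to [n], a bound for the degree of the product, and
   [tg <= sg'], [th <= sh'] have equal sums [j]. So [sg = 0], [tg = sg'] and [tg'] is the degree of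
   [g]. *)
rewrite !inE; move: jn s1 t1 s2 t2 lg lh S1 S2 sgh; clear.
by move: (size g) (size h); lia.
Qed.

(** The slope inequality is strict convexity at [j]: it puts the points beyond [j] strictly above
    the extended line of the other edge. *)
Lemma two_edges (p : nat) (f : {poly int}) (n j : nat) (x y z : int) :
  (0 < j < n)%N -> (size f <= n.+1)%N -> f`_0 != 0 -> f`_j != 0 -> f`_n != 0 ->
  vint p f`_0 = x -> vint p f`_j = y -> vint p f`_n = z ->
  (y - z) * j%:Z < (x - y) * (n - j)%N%:Z ->
  (forall i, (0 < i < j)%N -> f`_i != 0 ->
     (j - i)%N%:Z * x + i%:Z * y <= j%:Z * vint p f`_i) ->
  (forall i, (j < i < n)%N -> f`_i != 0 ->
     (n - i)%N%:Z * y + (i - j)%N%:Z * z <= (n - j)%N%:Z * vint p f`_i) ->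
  edge p j (x - y) f 0 j /\ edge p (n - j)%N (y - z) f j n.
Proof.
move=> jn sf f0 fj fn vx vy vz cvx below above.
have le_n i : f`_i != 0 -> (i <= n)%N.
  by move=> /coef_neq0_ltn fi; rewrite -ltnS; apply: leq_trans fi sf.
have lineL i : f`_i != 0 -> (i <= j)%N ->
    (j - i)%N%:Z * x + i%:Z * y <= j%:Z * vint p f`_i.
  move=> fi ij; have [i0|i0] := posnP i; first by subst i; rewrite vx; lia.
  have [ij'|ij'] := eqVneq i j; first by subst i; rewrite vy; lia.
  by apply: below => //; lia.
have lineR i : f`_i != 0 -> (j <= i)%N ->
    (n - i)%N%:Z * y + (i - j)%N%:Z * z <= (n - j)%N%:Z * vint p f`_i.
  move=> fi ij; have [i0|i0] := eqVneq i j; first by subst i; rewrite vy; lia.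
  have [ij'|ij'] := eqVneq i n; first by subst i; rewrite vz; lia.
  by apply: above => //; have := le_n i fi; lia.
split; split=> //; rewrite /weight ?vx ?vy ?vz; try lia.
- move=> i fi; have [ij|ij] := leqP i j.
    by have := lineL i fi ij; rewrite -subzn // => ?; nia.
  left; have := lineR i fi (ltnW ij); have := le_n i fi => le_in.
  set v := vint p _ => H.
  (* The claim follows by adding the slope inequality scaled by [i - j] and the bound [H] scaled by
     [j]. *)
  rewrite -(@ltr_pM2l _ (n - j)%N%:Z); last by lia.
  have : (y - z) * j%:Z * (i - j)%N%:Z < (x - y) * (n - j)%N%:Z * (i - j)%N%:Z.
    by rewrite ltr_pM2r; lia.
  have : j%:Z * ((n - i)%N%:Z * y + (i - j)%N%:Z * z) <= j%:Z * ((n - j)%N%:Z * v).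
    by rewrite ler_pM2l; lia.
  have -> : (n - j)%N%:Z = n%:Z - j%:Z by lia.
  have -> : (i - j)%N%:Z = i%:Z - j%:Z by lia.
  have -> : (n - i)%N%:Z = n%:Z - i%:Z by lia.
  nia.
- move=> i fi; have [ij|ij] := leqP j i.
    have := lineR i fi ij; have := le_n i fi => ?.
    by rewrite -!subzn //; try lia; nia.
  left; have := lineL i fi (ltnW ij).
  set v := vint p _ => H.
  rewrite -(@ltr_pM2l _ j%:Z); last by lia.
  have : (y - z) * j%:Z * (j - i)%N%:Z < (x - y) * (n - j)%N%:Z * (j - i)%N%:Z.
    by rewrite ltr_pM2r; lia.
  have : (n - j)%N%:Z * ((j - i)%N%:Z * x + i%:Z * y) <= (n - j)%N%:Z * (j%:Z * v).
    by rewrite ler_pM2l; lia.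
  have -> : (n - j)%N%:Z = n%:Z - j%:Z by lia.
  have -> : (j - i)%N%:Z = j%:Z - i%:Z by lia.
  nia.
Qed.

(** * From extended valuations to integer inequalities *)

Lemma nuE (p : nat) (x : int) : x != 0 -> nu p x = ((vint p x)%:~R)%:E.
Proof. by rewrite /nu => /negPf ->. Qed.

(** For [x = 0] the left side would be [+oo], which nothing exceeds; this gives the nonvanishing of
    the middle coefficients. *)
Lemma lt_nu_div (p : nat) (x y : int) (k l : nat) : (0 < k)%N -> (0 < l)%N ->
  y != 0 -> (nu p x / k%:R%:E < nu p y / l%:R%:E)%E ->
  x != 0 /\ vint p x * l%:Z < vint p y * k%:Z.
Proof.
move=> k0 l0 y0; rewrite !inver !pnatr_eq0 !gtn_eqF // (nuE _ y0) -EFinM.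
have [->|x0] := eqVneq x 0.
  by rewrite {1}/nu eqxx gt0_mulye // lte_fin invr_gt0 ltr0n.
rewrite nuE // -EFinM lte_fin ltr_pdivrMr ?ltr0n // mulrAC ltr_pdivlMr ?ltr0n //.
by rewrite -(ltr_int rat) !rmorphM.
Qed.

Lemma lt_nu_comb (p : nat) (x y z : int) (k l m : nat) : (0 < k)%N ->
  x != 0 -> y != 0 -> z != 0 ->
  ((l%:R / k%:R)%R%:E * nu p x + (m%:R / k%:R)%R%:E * nu p y < nu p z)%E ->
  l%:Z * vint p x + m%:Z * vint p y < k%:Z * vint p z.
Proof.
move=> k0 x0 y0 z0; rewrite !nuE // -!EFinM -EFinD lte_fin.
rewrite !(mulrAC _ _^-1) -mulrDl ltr_pdivrMr ?ltr0n //.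
by rewrite -(ltr_int rat) rmorphD !rmorphM /= [X in _ < X -> _]mulrC.
Qed.

Local Open Scope ereal_scope.

(* The gcd conditions use the integer-valued [vint]; every coefficient they
   mention is nonzero: a 0 and a n by assumption, and a j1, a j2 because
   [hp_first] and [hq_last] bound [nu p (a j1)] and [nu q (a j2)] above. *)
Theorem theorem1p48 (n : nat) (a : nat -> int) (f : {poly int})
  (f_def : f = (\poly_(i < n.+1) a i)%R)
  (a0an_neq0 : (a 0%N * a n != 0)%R)
  (p q : nat) (p_prime : prime p) (q_prime : prime q) (p_neq_q : p <> q)
  (j1 j2 : nat)
  (j1_range : (1 <= j1 <= n - 1)%N) (j2_range : (1 <= j2 <= n - 1)%N)
  (j1_neq_j2 : j1 <> j2) (j1j2_neq_n : (j1 + j2)%N <> n)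
  (hp_first : nu p (a 0%N) / n%:R%:E > nu p (a j1) / (n - j1)%N%:R%:E)
  (hp_below : forall i : nat, (0 < i < j1)%N ->
     nu p (a i) > ((j1 - i)%N%:R / j1%:R)%R%:E * nu p (a 0%N)
                  + (i%:R / j1%:R)%R%:E * nu p (a j1))
  (hp_j1 : nu p (a j1) > 0)
  (hp_above : forall i : nat, (j1 < i < n)%N ->
     nu p (a i) / (n - i)%N%:R%:E > nu p (a j1) / (n - j1)%N%:R%:E)
  (hp_last : nu p (a n) = 0)
  (hq_first : nu q (a 0%N) = 0)
  (hq_below : forall i : nat, (0 < i < j2)%N ->
     nu q (a i) / i%:R%:E > nu q (a j2) / j2%:R%:E)
  (hq_j2 : nu q (a j2) > 0)
  (hq_above : forall i : nat, (j2 < i < n)%N ->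
     nu q (a i) > ((n - i)%N%:R / (n - j2)%N%:R)%R%:E * nu q (a j2)
                  + ((i - j2)%N%:R / (n - j2)%N%:R)%R%:E * nu q (a n))
  (hq_last : nu q (a n) / n%:R%:E > nu q (a j2) / j2%:R%:E)
  (gcd_p_left : gcdz (vint p (a 0%N) - vint p (a j1))%R j1%:Z = 1%R)
  (gcd_p_right : gcdz (vint p (a j1)) (n - j1)%N%:Z = 1%R)
  (gcd_q_left : gcdz (vint q (a j2)) j2%:Z = 1%R)
  (gcd_q_right : gcdz (vint q (a n) - vint q (a j2))%R (n - j2)%N%:Z = 1%R) :
  irreducible_poly (map_poly (intr : int -> rat) f).
Proof.
have /norP[a0 an] : (~~ ((a 0%N == 0) || (a n == 0)))%R by rewrite -mulf_eq0.
have fE i : (i <= n)%N -> f`_i%R = a i by rewrite f_def coef_poly ltnS => ->.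
have sf : (size f <= n.+1)%N by rewrite f_def size_poly.
have j1n : (0 < j1 < n)%N by lia.
have j2n : (0 < j2 < n)%N by lia.
have [aj1 lt1] : a j1 != 0%R /\
    (vint p (a j1) * n%:Z < vint p (a 0%N) * (n - j1)%N%:Z)%R.
  by apply: (lt_nu_div _ _ a0 hp_first); lia.
have [aj2 lt2] : a j2 != 0%R /\ (vint q (a j2) * n%:Z < vint q (a n) * j2%:Z)%R.
  by apply: (lt_nu_div _ _ an hq_last); lia.
have vpn : vint p (a n) = 0%R.
  by move: hp_last; rewrite nuE // => -[] /eqP; rewrite intr_eq0 => /eqP.
have vq0 : vint q (a 0%N) = 0%R.
  by move: hq_first; rewrite nuE // => -[] /eqP; rewrite intr_eq0 => /eqP.
(* Here [d] is the drop in valuation along an edge and [w] its width, so the gcd conditions are, up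
   to sign, their coprimality. *)
have [P1 P2] : edge p j1 (vint p (a 0%N) - vint p (a j1)) f 0 j1 /\
    edge p (n - j1)%N (vint p (a j1) - 0) f j1 n.
  apply: two_edges; rewrite ?fE //; try lia.
  - move=> i ij; rewrite fE => [ai|]; last by lia.
    by apply/ltW/lt_nu_comb => //; [lia | apply: hp_below].
  - move=> i ij; rewrite fE => [ai|]; last by lia.
    have [i1 i2] : (0 < n - j1 /\ 0 < n - i)%N by lia.
    by case: (lt_nu_div i1 i2 ai (hp_above i ij)) => _; lia.
have [Q1 Q2] : edge q j2 (0 - vint q (a j2)) f 0 j2 /\
    edge q (n - j2)%N (vint q (a j2) - vint q (a n)) f j2 n.
  apply: two_edges; rewrite ?fE //; try lia.
  - move=> i ij; rewrite fE => [ai|]; last by lia.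
    have [i1 i2] : (0 < j2 /\ 0 < i)%N by lia.
    by case: (lt_nu_div i1 i2 ai (hq_below i ij)) => _; lia.
  - move=> i ij; rewrite fE => [ai|]; last by lia.
    by apply/ltW/lt_nu_comb => //; [lia | apply: hq_above].
have size_F : size (map_poly (intr : int -> rat) f) = n.+1.
  rewrite size_map_poly_id0 ?intr_eq0; first by rewrite f_def size_poly_eq.
  by rewrite lead_coef_eq0; apply: contraNneq an => f0; rewrite -fE // f0 coef0.
split; first by rewrite size_F; lia.
move=> r r_neq1 r_dvd; rewrite -dvdp_size_eqp // size_F.
(* Gauss's lemma: a rational divisor is proportional to some [g] that divides [f] over the
   integers. *)
have [g [c c0 rE] [h fgh]] := dvdpP_rat_int r_dvd.
have sz : size r = size g.
  by rewrite rE size_scale // size_map_inj_poly //; exact: intr_inj.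
have r_neq0 : r != 0%R.
  by apply: contraTneq r_dvd => ->; rewrite dvd0p -size_poly_eq0 size_F.
rewrite sz -size_poly_eq0 sz in r_neq1 r_neq0 *.
rewrite fgh in sf P1 P2 Q1 Q2.
have cp1 : coprimez (vint p (a 0%N) - vint p (a j1)) j1 by apply/eqP.
have cp2 : coprimez (vint p (a j1) - 0) (n - j1)%N by rewrite subr0; apply/eqP.
have cq1 : coprimez (0 - vint q (a j2)) j2 by rewrite sub0r coprimeNz; apply/eqP.
have cq2 : coprimez (vint q (a j2) - vint q (a n)) (n - j2)%N.
  by rewrite -opprB coprimeNz; apply/eqP.
have := two_edges_factor_size p_prime j1n sf P1 P2 cp1 cp2.
have := two_edges_factor_size q_prime j2n sf Q1 Q2 cq1 cq2.
rewrite !inE; move: (size g) r_neq0 r_neq1 lt1 lt2 => k k0 k1 lt1 lt2.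
(* After expansion, [lt2] and [lt1] are the strict convexity at [j2] and [j1]. *)
have -> : ((vint q (a j2) - vint q (a n)) * j2 < (0 - vint q (a j2)) * (n - j2)%N)%R.
  by lia.
have -> : ((vint p (a j1) - 0) * j1 < (vint p (a 0%N) - vint p (a j1)) * (n - j1)%N)%R.
  by lia.
(* The size [k] is one more than the degree. A nonzero degree in both lists is [n], as any other
   coincidence forces [j1 = j2] or [j1 + j2 = n]. *)
move=> /(_ isT) + /(_ isT); move: k0 k1 j1n j2n j1_neq_j2 j1j2_neq_n; clear; lia.
Qed.
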